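(* Let $G$ be a finite graph. If $G$ is square-decomposable, then $\gamma_G(n)=O(\log(n))$.
   Context: Graphs are undirected, connected, without multiple edges, self-loops allowed; $V_G$, $E_G$ are the sets of vertices and edges of $G$. Walks: a walk on $G$ is a non-empty word $p=p_0\dots p_n$ of vertices with $(p_i,p_{i+1})\in E_G$ for all $i<n$; its length is $l(p)=n$. A cycle is a walk $c$ with $c_0=c_{l(c)}$; it is simple if $i<j$ and $c_i=c_j$ imply $i=0$ and $j=l(c)$; it is empty if it has length $0$. A spine on $a$ is a cycle of length $2$ starting and ending at $a$. A walk is non-backtracking if it has no spine as a subword (of consecutive letters). $\varphi(p)$ denotes the walk obtained from $p$ by successively replacing every spine $aba$ by $a$ until none is left (the result does not depend on the order). For a walk $p$, $0\le k\le l(p)$ and a cycle $s$ with $s_0=p_k$, $p\oplus_k s=p_0\dots p_{k-1}\,s\,p_{k+1}\dots p_{l(p)}$. A square is a non-backtracking cycle of length $4$. Two non-backtracking walks $p,q$ differ by a square if there are an integer $k$ and a square $s$ with $q=\varphi(p\oplus_k s)$ or $p=\varphi(q\oplus_k s)$. $\sim_\square$ is the equivalence relation on non-backtracking walks generated by this relation. A simple cycle $c$ is decomposable into squares if $\varphi(c)\sim_\square c'$ for some empty cycle $c'$ (for non-backtracking $c$, $\varphi(c)=c$). $G$ is square-decomposable if all its simple cycles are decomposable into squares. Hom shift: $X_G\subset V_G^{\mathbb Z^2}$ is the set of all $x$ such that $(x_{\mathbf u},x_{\mathbf v})\in E_G$ whenever $\mathbf u,\mathbf v\in\mathbb Z^2$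 satisfy $\|\mathbf u-\mathbf v\|_1=1$. Block gluing: $\mathbb N=\{0,1,\dots\}$, $\mathbb N^*=\{1,2,\dots\}$. A block pattern of size $n\ge1$ is an element of $\mathcal A^{\{0,\dots,n-1\}^2}$; it is globally admissible for a shift $X\subset\mathcal A^{\mathbb Z^2}$ if it appears in some element of $X$. $\delta(\mathbb U,\mathbb U')=\min_{\mathbf u\in\mathbb U,\mathbf u'\in\mathbb U'}\|\mathbf u-\mathbf u'\|_\infty$. For $f:\mathbb N^*\to\mathbb N$, $k\in\mathbb N^*$, $X$ is $(f,k)$-phased block gluing if for all $n\ge1$, all globally admissible block patterns $p,p'$ of size $n$ and all $\mathbf u,\mathbf u'$ with $\delta(\mathbf u+\{0,\dots,n-1\}^2,\mathbf u'+\{0,\dots,n-1\}^2)\ge f(n)$, there are $x\in X$ and $\mathbf v\in\mathbb Z^2$ with $\|\mathbf v\|_\infty<k$ such that $x$ restricted to $\mathbf u+\{0,\dots,n-1\}^2$ is $p$ and $x$ restricted to $\mathbf u'+\mathbf v+\{0,\dots,n-1\}^2$ is $p'$. For finite connected $G$, $X_G$ is $(f,k)$-phased block gluing for some $(f,k)$; its phase $\theta$ is the minimal such $k$, and $\gamma_G:\mathbb N^*\to\mathbb N$ is the pointwise minimal function such that $X_G$ is $(\gamma_G,\theta)$-phased block gluing. $g(n)=O(f(n))$ means there are $c,K>0$ with $g(n)\le c f(n)+K$ for all $n\ge 1$. *)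

(* Defs.v *)
From HB Require Import structures.
From Stdlib Require Import Relation_Operators.
From mathcomp Require Import all_boot all_order all_algebra.
From mathcomp Require Import reals exp.

Set Implicit Arguments.
Unset Strict Implicit.
Unset Printing Implicit Defensive.

Import Order.TTheory GRing.Theory Num.Theory.
Local Open Scope ring_scope.

(* A graph is a symmetric relation e : rel V on its vertex type; loops are     *)
(* the vertices a with e a a.  A walk is the sequence of its letters, so its   *)
(* length is (size p).-1.                                                      *)
Section Walks.
Variables (V : finType) (e : rel V).
Implicit Types p q c s : seq V.

Definition walk p : bool := if p is x :: p' then path e x p' else false.

Definition walk_length p : nat := (size p).-1.

Definition closed_walk c : bool :=
  if c is x :: c' then path e x c' && (last x c' == x) else false.

Definition simple_cycle c : Prop :=
  closed_walk c /\
  forall i j, (i < j <= walk_length c)%N -> onth c i = onth c j ->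
    i = 0%N /\ j = walk_length c.

Definition empty_cycle c : Prop := closed_walk c /\ walk_length c = 0%N.

(* b = a is possible, when a carries a loop *)
Definition spine s : Prop :=
  closed_walk s /\ walk_length s = 2%N.

Definition nonbacktracking p : Prop :=
  walk p /\ forall s, spine s -> ~~ infix s p.

(* phi treats the letters from right to left, keeping a word without spine.    *)
(* In a walk, a factor aba is a spine.  By lemmas phi_steps,                   *)
(* phi_nonbacktracking and phi_unique below, phi p is the result of replacing  *)
(* the spines of p until none is left, in whatever order.                      *)
Definition push (x : V) (r : seq V) : seq V :=
  match r with
  | _ :: z :: _ => if x == z then behead r else x :: r
  | _ => x :: r
  end.

Definition phi p : seq V := foldr push [::] p.

(* The walk p_0 .. p_(k-1) s p_(k+1) .. p_(l(p)). *)
Definition insert_cycle p (k : nat) s : seq V := take k p ++ s ++ drop k.+1 p.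

Definition square s : Prop :=
  [/\ nonbacktracking s, closed_walk s & walk_length s = 4%N].

Definition adds_square p q : Prop :=
  exists k s, [/\ (k <= walk_length p)%N, square s, onth s 0 = onth p k
                & q = phi (insert_cycle p k s)].

Definition differ_by_square p q : Prop :=
  [/\ nonbacktracking p, nonbacktracking q & adds_square p q \/ adds_square q p].

Definition square_equiv : seq V -> seq V -> Prop :=
  clos_refl_sym_trans (seq V) differ_by_square.

Definition decomposable_into_squares c : Prop :=
  exists c', empty_cycle c' /\ square_equiv (phi c) c'.

Definition square_decomposable : Prop :=
  forall c, simple_cycle c -> decomposable_into_squares c.

Definition spine_step p q : Prop :=
  exists u a b v, p = u ++ [:: a; b; a] ++ v /\ q = u ++ a :: v.

Definition spine_steps : seq V -> seq V -> Prop :=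
  clos_refl_trans (seq V) spine_step.

(* Absence of a factor aba. *)
Fixpoint spineless p : bool :=
  match p with
  | x :: p' => (if p' is _ :: z :: _ then x != z else true) && spineless p'
  | [::] => true
  end.

Lemma spineless_cons x p :
  spineless (x :: p) = (if p is _ :: z :: _ then x != z else true) && spineless p.
Proof. by []. Qed.

Lemma spinelessPn p :
  reflect (exists u a b v, p = u ++ [:: a; b; a] ++ v) (~~ spineless p).
Proof.
apply: (iffP idP) => [|[u [a [b [v ->]]]]]; last first.
  elim: u => [|x u IHu]; first by rewrite /= eqxx.
  by rewrite cat_cons spineless_cons negb_and IHu orbT.
elim: p => [|x p IHp] //; rewrite spineless_cons negb_and => /orP[|/IHp].
  case: p {IHp} => [|y [|z p]] //; rewrite negbK => /eqP->.
  by exists [::], z, y, p.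
by move=> [u [a [b [v ->]]]]; exists (x :: u), a, b, v.
Qed.

Lemma walk_cat_r u p : p != [::] -> walk (u ++ p) -> walk p.
Proof.
case: p => [|y p] // _; case: u => [|x u] //=.
by rewrite cat_path /= => /and3P[].
Qed.

Lemma nonbacktrackingE p : nonbacktracking p <-> walk p && spineless p.
Proof.
split=> [[wp nbp]|/andP[wp sp]].
  rewrite wp /=; apply/negPn/negP => /spinelessPn[u [a [b [v Ep]]]].
  have /nbp : spine [:: a; b; a].
    split=> //=; move: wp; rewrite Ep => /walk_cat_r /= /(_ isT).
    by move=> /and3P[-> -> _]; rewrite eqxx.
  by case/negP; apply/infixP; exists u, v.
split=> // s [cs ls]; apply/negP => /infixP[u [v Ep]].
suff : ~~ spineless p by rewrite sp.
case: s cs ls Ep => [|a [|b [|a' [|? ?]]]] //= /andP[_ /eqP->] _ ->.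
by apply/spinelessPn; exists u, a, b, v.
Qed.

Lemma push_spineless x r : spineless r -> spineless (push x r).
Proof.
case: r => [|y [|z r]] // sr; rewrite /push.
have [xz|xz] := eqVneq x z; last by rewrite spineless_cons xz.
by move: sr; rewrite spineless_cons => /andP[].
Qed.

Lemma phi_spineless p : spineless (phi p).
Proof. by elim: p => //= x p IHp; apply: push_spineless. Qed.

Lemma phi_id p : spineless p -> phi p = p.
Proof.
elim: p => [|x p IHp] //; rewrite spineless_cons => /andP[xp /IHp Ep].
rewrite /phi /= -/(phi p) Ep.
by case: p xp {IHp Ep} => [|y [|z p]] //= /negPf ->.
Qed.

Lemma push_spine a b r : spineless r -> push a (push b (push a r)) = push a r.
Proof.
move=> /(@push_spineless a); have [s ->] : exists s, push a r = a :: s.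
  case: r => [|y [|z r]] /=; try by eexists.
  by case: (eqVneq a z) => [->|_]; eexists.
case: s => [|z s] sr; first by rewrite /= eqxx.
rewrite [push b _]/=; case: (eqVneq b z) => [_|bz]; last by rewrite /= eqxx.
case: s sr => [|t s] //; rewrite spineless_cons => /andP[/negPf at_ _].
by rewrite /= at_.
Qed.

Lemma phi_step p q : spine_step p q -> phi p = phi q.
Proof.
move=> [u [a [b [v [-> ->]]]]]; rewrite /phi !foldr_cat /=; congr foldr.
exact: push_spine (phi_spineless v).
Qed.

Lemma spine_steps_cons x p q : spine_steps p q -> spine_steps (x :: p) (x :: q).
Proof.
elim=> {p q} [p q [u [a [b [v [-> ->]]]]]|p|p q r _ pq _ qr].
- by apply: rt_step; exists (x :: u), a, b, v.
- exact: rt_refl.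
- exact: rt_trans pq qr.
Qed.

Lemma phi_steps p : spine_steps p (phi p).
Proof.
elim: p => [|x p IHp]; first exact: rt_refl.
apply: rt_trans (spine_steps_cons x IHp) _; rewrite [phi (x :: p)]/=.
rewrite -/(phi p); case: (phi p) => [|y [|z r]] /=; try exact: rt_refl.
case: (eqVneq x z) => [->|_]; last exact: rt_refl.
by apply: rt_step; exists [::], z, y, r.
Qed.

Lemma walk_spine_steps p q : spine_steps p q -> walk p -> walk q.
Proof.
elim=> {p q} [p q [u [a [b [v [-> ->]]]]]| |p q r _ pq _ qr] //; last first.
  by move=> /pq /qr.
case: u => [|x u] /=; first by case/and3P.
by rewrite !cat_path /= => /and5P[-> -> _ _ ->].
Qed.

Lemma phi_nonbacktracking p : walk p -> nonbacktracking (phi p).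
Proof.
move=> wp; apply/nonbacktrackingE; rewrite phi_spineless.
by rewrite (walk_spine_steps (phi_steps p)).
Qed.

Lemma phi_unique p q : spine_steps p q -> nonbacktracking q -> q = phi p.
Proof.
move=> pq /nonbacktrackingE /andP[_ sq]; rewrite -[LHS](phi_id sq).
elim: pq {sq} => [{}p {}q /phi_step ->||{}p r {}q _ pr _ rq] //.
by rewrite rq.
Qed.

End Walks.

(* Z^2 is int * int, with its componentwise additive group structure. *)
Definition norm1 (u : int * int) : nat := (`|u.1| + `|u.2|)%N.
Definition norm_oo (u : int * int) : nat := maxn `|u.1|%N `|u.2|%N.

Definition hom_shift (V : finType) (e : rel V) (x : int * int -> V) : Prop :=
  forall u v : int * int, norm1 (u - v) = 1%N -> e (x u) (x v).

Section BlockGluing.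
Variables (A : Type) (X : (int * int -> A) -> Prop).

Definition pattern n := {ffun 'I_n * 'I_n -> A}.

Definition cell n (u : int * int) (i : 'I_n * 'I_n) : int * int :=
  u + (i.1%:Z, i.2%:Z).

Definition appears_at n (p : pattern n) (x : int * int -> A) (u : int * int) :=
  forall i, x (cell u i) = p i.

Definition globally_admissible n (p : pattern n) : Prop :=
  exists x u, X x /\ appears_at p x u.

(* Minimum of the distances between the cells of two blocks of size n.  For    *)
(* n > 0 the initial value norm_oo (u - u') is one of these distances.         *)
Definition block_dist n (u u' : int * int) : nat :=
  \big[minn/norm_oo (u - u')]_(i : ('I_n * 'I_n) * ('I_n * 'I_n))
    norm_oo (cell u i.1 - cell u' i.2).

Lemma leq_block_dist m n (u u' : int * int) : (0 < n)%N ->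
  (m <= block_dist n u u')%N <->
  forall i j : 'I_n * 'I_n, (m <= norm_oo (cell u i - cell u' j)%R)%N.
Proof.
move=> n0; split=> [mD i j|mD].
  apply: leq_trans mD _; rewrite /block_dist.
  have := mem_index_enum (i, j); elim: (index_enum _) => // k s IHs.
  rewrite inE big_cons => /predU1P[<-|/IHs]; first exact: geq_minl.
  by apply: leq_trans; exact: geq_minr.
rewrite /block_dist; elim/big_ind: _ => [|x y mx my|[i j] _] //.
  have := mD (Ordinal n0, Ordinal n0) (Ordinal n0, Ordinal n0).
  by rewrite /cell /= -[(0, 0)]/(0 : int * int) !addr0.
by rewrite leq_min mx.
Qed.

(* Functions on {1, 2, ..} are given by functions on nat, whose value at 0 is  *)
(* never used.                                                                 *)
Definition phased_block_gluing (f : nat -> nat) (k : nat) : Prop :=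
  forall n, (0 < n)%N -> forall p p' : pattern n,
  globally_admissible p -> globally_admissible p' ->
  forall u u' : int * int, (f n <= block_dist n u u')%N ->
  exists x v, [/\ X x, (norm_oo v < k)%N, appears_at p x u
                & appears_at p' x (u' + v)].

Definition is_phase (theta : nat) : Prop :=
  [/\ (0 < theta)%N, exists f, phased_block_gluing f theta
    & forall k f, (0 < k)%N -> phased_block_gluing f k -> (theta <= k)%N].

Definition is_gluing_gap (gamma : nat -> nat) : Prop :=
  exists theta, [/\ is_phase theta, phased_block_gluing gamma theta
    & forall f, phased_block_gluing f theta ->
      forall n, (0 < n)%N -> (gamma n <= f n)%N].

Lemma is_gluing_gap_unique gamma gamma' :
  is_gluing_gap gamma -> is_gluing_gap gamma' ->
  forall n, (0 < n)%N -> gamma n = gamma' n.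
Proof.
move=> [t [[t0 _ tmin] gt gmin]] [t' [[t'0 _ t'min] gt' gmin']] n n0.
have tt' : t = t' by apply/eqP; rewrite eqn_leq (tmin _ _ t'0 gt') (t'min _ _ t0 gt).
by subst t'; apply/eqP; rewrite eqn_leq gmin // gmin'.
Qed.

End BlockGluing.

Definition is_bigO (R : realType) (g f : nat -> R) : Prop :=
  exists c K : R, [/\ 0 < c, 0 < K
    & forall n, (0 < n)%N -> g n <= c * f n + K].

(* Main.v *)
(* A walk of length n is deformed through walks adjacent letter by letter to   *)
(* the preceding one; a strip between two blocks is such a deformation of the  *)
(* boundary row of one block into that of the other, and it suffices to reach  *)
(* a zigzag a b a b .. from every row in O(log n) steps.                       *)
(*                                                                             *)
(* Square-decomposability makes every cycle null-homotopic, so walks of        *)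
(* bounded length shrink to length < #|V| in bounded time, provided that a     *)
(* fixed number I of spines is available next to them.  A spine moves across   *)
(* an arbitrarily long walk in one step (the walk is just shifted), and a      *)
(* zigzag of any length moves across one letter in two steps.  Hence a shrunk  *)
(* segment, which releases spines, can feed a segment arbitrarily far away:    *)
(* shrink the last L letters, send I spines to the middle, and treat both      *)
(* halves in parallel.  A walk of length 2^k thus shrinks in time O(k).        *)
(*                                                                             *)
(* For the gap to concern the phase 2 it remains to see that the phase is not  *)
(* 1 when G has an edge: null-homotopic cycles have even length.               *)

Require Import Defs.
From Stdlib Require Import Relation_Operators.
From mathcomp Require Import all_boot all_order all_algebra.
From mathcomp Require Import zify.
From mathcomp Require Import boolp reals exp.

Set Implicit Arguments.
Unset Strict Implicit.
Unset Printing Implicit Defensive.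

Import Order.TTheory GRing.Theory Num.Theory.
Local Open Scope ring_scope.

(** * Deformations of walks with fixed endpoints *)

(** The row bounding a block is continued periodically beyond it and evolves row by row away from
    the block. It suffices that every such row reaches an alternation of two fixed adjacent letters
    in O(log n) steps ([settles_ray]): two blocks are then separated by stripes that agree up to
    parity, and moving one pattern by at most one column corrects the parity ([glue_above]).

    Deformations preserve length, so a walk is shortened by turning its excess letters into spines
    gathered at its end. Modulo spines, squares contract ([sim_square]), hence simple cycles do by
    hypothesis, and every walk is homotopic to one without repeated vertex ([sim_shorten]). By
    finiteness, walks of bounded length need only bounded time and boundedly many spare spines
    ([shrinks_bounded]). Since spines travel cheaply ([conn_slide], [conn_pass]), doubling the
    length of a walk costs only a constant extra time ([shrinks_dyadic]), whence the logarithm.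

    Homotopy also preserves the parity of the length, so closed walks are even ([closed_walk_even]).
    This excludes phase 1 as soon as there is an edge, and the bound, proved with displacements of
    norm at most 1, concerns the true gap. *)

Section WalkMoves.
Local Open Scope nat_scope.
Variables (V : finType) (e : rel V) (nb : V -> V).
Hypothesis e_sym : symmetric e.
Hypothesis e_nb : forall a, e a (nb a).
Implicit Types (a b c : V) (s t u v : seq V).

Definition zigzag a b n : seq V := flatten (nseq n [:: b; a]).
Definition Z a := zigzag a (nb a).

Lemma zigzagS a b n : zigzag a b n.+1 = b :: a :: zigzag a b n.
Proof. by []. Qed.

Lemma zigzagD a b m n : zigzag a b (m + n) = zigzag a b m ++ zigzag a b n.
Proof. by rewrite /zigzag nseqD flatten_cat. Qed.

Lemma ZD a m n : Z a (m + n) = Z a m ++ Z a n.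
Proof. exact: zigzagD. Qed.

Lemma last_zigzag a b n : last a (zigzag a b n) = a.
Proof. by elim: n. Qed.

Lemma last_Z a n : last a (Z a n) = a. Proof. exact: last_zigzag. Qed.

Lemma size_zigzag a b n : size (zigzag a b n) = n.*2.
Proof. by elim: n => //= n ->; rewrite doubleS. Qed.

Lemma size_Z a n : size (Z a n) = n.*2. Proof. exact: size_zigzag. Qed.

Lemma path_zigzag a b n : e a b -> path e a (zigzag a b n).
Proof. by move=> ab; elim: n => //= n ->; rewrite ab e_sym ab. Qed.

Lemma path_Z a n : path e a (Z a n). Proof. exact: path_zigzag. Qed.

Lemma zigzag_rcons a b n : zigzag a b n ++ [:: b] = b :: zigzag b a n.
Proof. by elim: n => //= n IHn; rewrite -/(zigzag a b n) IHn. Qed.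

Lemma path_all2 a s : path e a s = all2 e (belast a s) s.
Proof. by elim: s a => //= b s IHs a; rewrite IHs. Qed.

Lemma all2_sym s t : all2 e s t = all2 e t s.
Proof. by elim: s t => [|x s IHs] [|y t] //=; rewrite IHs e_sym. Qed.

(* The letters of t are compared with those of a :: s one place to the left:   *)
(* this makes the relation reflexive and compatible with concatenation, and    *)
(* turns into adjacency of rows once t is translated by one.                   *)
Definition drift a s t : bool :=
  [&& path e a s, path e a t, last a s == last a t & all2 e (belast a s) t].

Lemma drift_refl a s : path e a s -> drift a s s.
Proof. by move=> as_; rewrite /drift as_ eqxx -path_all2. Qed.

Lemma all2_cat (s1 s2 t1 t2 : seq V) : size s1 = size t1 ->
  all2 e (s1 ++ s2) (t1 ++ t2) = all2 e s1 t1 && all2 e s2 t2.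
Proof.
elim: s1 t1 => [|x s1 IHs] [|y t1] //= [/IHs ->]; by rewrite andbA.
Qed.

Lemma all2_size (s t : seq V) : all2 e s t -> size s = size t.
Proof. by elim: s t => [|x s IHs] [|y t] //= /andP[_ /IHs ->]. Qed.

Lemma drift_size a s t : drift a s t -> size s = size t.
Proof. by case/and4P=> _ _ _ /all2_size; rewrite size_belast. Qed.

Lemma drift_cat a s t s' t' : drift a s t -> drift (last a s) s' t' ->
  drift a (s ++ s') (t ++ t').
Proof.
move=> d d'; have sz := drift_size d.
case/and4P: d => ps pt /eqP lst al; case/and4P: d' => ps' pt' lst' al'.
rewrite /drift !cat_path !last_cat -lst ps pt ps' pt' lst' belast_cat.
by rewrite all2_cat ?size_belast // al.
Qed.

(** A [drift] shifts by one place; going to [v] and coming back cancels the shift and makes the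
    relation symmetric. *)
Definition step a s t : Prop := exists v, drift a s v /\ drift a t v.

Lemma step_sym a s t : step a s t -> step a t s.
Proof. by case=> v []; exists v. Qed.

Lemma drift_step a s t : drift a s t -> step a s t.
Proof.
by move=> d; exists t; split=> //; apply: drift_refl; case/and4P: d.
Qed.

Lemma step_cat a s t s' t' : step a s t -> step (last a s) s' t' ->
  step a (s ++ s') (t ++ t').
Proof.
move=> [v [sv tv]] [v' [sv' tv']]; exists (v ++ v'); split.
  exact: drift_cat.
apply: drift_cat => //; suff <- : last a s = last a t by [].
by case/and4P: sv => _ _ /eqP-> _; case/and4P: tv => _ _ /eqP-> _.
Qed.

Lemma step_inv a s t : step a s t ->
  [/\ path e a s, path e a t, last a s = last a t & size s = size t].
Proof.
move=> [v [sv tv]]; split; first by case/and4P: sv.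
- by case/and4P: tv.
- by case/and4P: sv => _ _ /eqP-> _; case/and4P: tv => _ _ /eqP-> _.
- by rewrite (drift_size sv) (drift_size tv).
Qed.

Fixpoint conn k a s t : Prop :=
  if k is k'.+1 then exists v, step a s v /\ conn k' a v t
  else path e a s /\ s = t.

Lemma conn_inv k a s t : conn k a s t ->
  [/\ path e a s, path e a t, last a s = last a t & size s = size t].
Proof.
elim: k s => [|k IHk] s /=; first by case=> ? <-.
by case=> v [/step_inv[ps _ -> ->] /IHk[_ -> -> ->]].
Qed.

Lemma conn_refl k a s : path e a s -> conn k a s s.
Proof.
move=> ps; elim: k => //= k IHk; exists s; split=> //.
exact/drift_step/drift_refl.
Qed.

Lemma conn_trans k k' a s t v :
  conn k a s t -> conn k' a t v -> conn (k + k') a s v.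
Proof.
elim: k s => [|k IHk] s /=; first by case=> _ ->.
by case=> r [sr rt] tv; exists r; split=> //; apply: IHk.
Qed.

Lemma step_conn a s t : step a s t -> conn 1 a s t.
Proof. by move=> st; exists t; split=> //; case: (step_inv st). Qed.

Lemma conn_sym k a s t : conn k a s t -> conn k a t s.
Proof.
elim: k s => [|k IHk] s /=; first by case=> ? <-.
case=> v [/step_sym/step_conn sv /IHk vt].
by move: (conn_trans vt sv); rewrite addn1.
Qed.

Lemma conn_le k k' a s t : k <= k' -> conn k a s t -> conn k' a s t.
Proof.
move=> /subnKC <- st; have [_ pt _ _] := conn_inv st.
exact: conn_trans st (conn_refl _ pt).
Qed.

Lemma conn_cat k a s t s' t' : conn k a s t -> conn k (last a s) s' t' ->
  conn k a (s ++ s') (t ++ t').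
Proof.
elim: k s s' => [|k IHk] s s' /=.
  by case=> ps <- [ps' <-]; rewrite cat_path ps.
case=> v [sv vt] [v' [sv' vt']]; exists (v ++ v'); split; first exact: step_cat.
by apply: IHk => //; case: (step_inv sv) => _ _ <-.
Qed.

Lemma conn_catl k a u s t : path e a u -> conn k (last a u) s t ->
  conn k a (u ++ s) (u ++ t).
Proof. by move=> pu; apply: conn_cat; apply: conn_refl. Qed.

Lemma conn_catr k a u s t : conn k a s t -> path e (last a s) u ->
  conn k a (s ++ u) (t ++ u).
Proof. by move=> st pu; apply: conn_cat st (conn_refl _ _). Qed.

Lemma conn_flip a b b' c : e a b -> e b c -> e a b' -> e b' c ->
  conn 1 a [:: b; c] [:: b'; c].
Proof.
move=> ab bc ab' b'c; apply/step_conn/drift_step.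
by rewrite /drift /= ab bc ab' b'c eqxx.
Qed.

Lemma conn_zigzag a b b' n : e a b -> e a b' ->
  conn 1 a (zigzag a b n) (zigzag a b' n).
Proof.
move=> ab ab'; apply/step_conn/drift_step.
rewrite /drift !path_zigzag // !last_zigzag eqxx /=.
by elim: n => //= n ->; rewrite ab' e_sym ab.
Qed.

(** Inserting a spine in front delays [s] by two places. Compared one place to the left, each letter
    of [s] faces its own predecessor, to which it is adjacent, however long [s] is. *)
Lemma conn_slide1 a s : path e a s ->
  conn 1 a (s ++ Z (last a s) 1) (Z a 1 ++ s).
Proof.
move=> ps; apply/step_conn/drift_step.
rewrite /drift cat_path ps path_Z (last_cat a (Z a 1)) last_Z last_cat last_Z.
rewrite eqxx /= ps e_nb e_sym e_nb /= belast_cat /=.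
rewrite -cat_rcons -lastI /= e_nb /= all2_sym.
have -> : a :: s = belast a (rcons s (nb (last a s))) by rewrite belast_rcons.
by rewrite cats1 -path_all2 rcons_path ps e_nb.
Qed.

Lemma conn_slide n a s : path e a s ->
  conn n a (s ++ Z (last a s) n) (Z a n ++ s).
Proof.
move=> ps; elim: n => [|n IHn]; first by rewrite cats0.
rewrite -addn1 ZD catA; apply: conn_trans (conn_catr IHn _) _.
  by rewrite last_cat last_Z path_Z.
rewrite ZD -!catA; apply: conn_catl; rewrite ?path_Z // last_Z.
exact: conn_slide1.
Qed.

(** To cross a letter [c], the whole zigzag is changed in one step to alternate between [a] and [c];
    it is then also a zigzag based at [c], reset in a second step. The cost does not depend on
    [n]. *)
Lemma conn_pass n a s : path e a s ->
  conn (size s).*2 a (Z a n ++ s) (s ++ Z (last a s) n).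
Proof.
elim: s a => [|c s IHs] a.
  by rewrite cats0 => _; split; rewrite ?path_Z.
rewrite [path _ _ _]/= => /andP[ac ps].
rewrite -cat1s catA -[_.*2]/(2 + (size s).*2).
have ca : e c a by rewrite e_sym.
apply: (@conn_trans 2 _ _ _ ([:: c] ++ Z c n ++ s)); last first.
  by apply: conn_catl; rewrite /= ?ac //; apply: IHs.
rewrite catA; apply: conn_catr; last by rewrite last_cat last_Z.
apply: (@conn_trans 1 1 _ _ (zigzag a c n ++ [:: c])).
  by apply: conn_catr; [exact: conn_zigzag|rewrite last_Z /= ac].
by rewrite zigzag_rcons -cat1s; apply: conn_catl;
  [rewrite /= ac|exact: conn_zigzag].
Qed.

(** * Homotopy of walks *)

(** Homotopy: the spines on both sides absorb the difference of lengths, and the time is left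
    unbounded. *)
Definition sim a s t : Prop :=
  exists i j k, conn k a (s ++ Z (last a s) i) (t ++ Z (last a t) j).

Lemma sim_inv a s t : sim a s t -> [/\ path e a s, path e a t,
  last a s = last a t & odd (size s) = odd (size t)].
Proof.
move=> [i [j [k /conn_inv]]]; rewrite !cat_path !last_cat !last_Z !size_cat.
rewrite !size_Z; case=> /andP[-> _] /andP[-> _] -> /(congr1 odd).
by rewrite !oddD !odd_double !addbF.
Qed.

Lemma sim_conn k a s t : conn k a s t -> sim a s t.
Proof. by exists 0, 0, k; rewrite !cats0. Qed.

Lemma sim_refl a s : path e a s -> sim a s s.
Proof. by move=> ps; apply: (@sim_conn 0). Qed.

Lemma sim_sym a s t : sim a s t -> sim a t s.
Proof. by case=> i [j [k /conn_sym c]]; exists j, i, k. Qed.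

Lemma sim_trans a s t v : sim a s t -> sim a t v -> sim a s v.
Proof.
move=> [i [j [k st]]] [i' [j' [k' tv]]].
exists (i + i'), (j' + j), (k + k').
have [ps pt lst _] := conn_inv st; have [_ pv lv _] := conn_inv tv.
rewrite !last_cat !last_Z in lst lv.
rewrite lst in st *; rewrite -lv in tv *.
apply: (@conn_trans _ _ _ _ (t ++ Z (last a t) (j + i'))).
  rewrite !ZD !catA; apply: conn_catr => //.
  by rewrite last_cat lst last_Z path_Z.
rewrite (addnC j) !ZD !catA; apply: conn_catr => //.
by rewrite last_cat last_Z path_Z.
Qed.

Lemma sim_cat a s t s' t' : sim a s t -> sim (last a s) s' t' ->
  sim a (s ++ s') (t ++ t').
Proof.
move=> st st'; have [ps pt lst _] := sim_inv st.
have [ps' pt' lst' _] := sim_inv st'.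
case: st st' => [i [j [k st]]] [i' [j' [k' st']]].
exists (i + i'), (j + j'), (i + ((k + k') + j)).
rewrite !last_cat -lst !ZD.
apply: (@conn_trans _ _ _ _ ((s ++ Z (last a s) i) ++
                             (s' ++ Z (last (last a s) s') i'))).
  rewrite -!catA; apply: conn_catl => //; rewrite !catA.
  by apply: conn_catr; [exact: conn_slide|rewrite last_cat last_Z path_Z].
apply: (@conn_trans _ _ _ _ ((t ++ Z (last a t) j) ++
                             (t' ++ Z (last (last a t) t') j'))).
  apply: conn_cat; first by apply: conn_le st; apply: leq_addr.
  by rewrite last_cat last_Z -lst; apply: conn_le st'; apply: leq_addl.
apply: conn_sym; rewrite -!catA -lst; apply: conn_catl => //; rewrite -lst !catA.
by apply: conn_catr; [exact: conn_slide|rewrite last_cat last_Z path_Z].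
Qed.

Lemma sim_spine a b : e a b -> sim a [:: b; a] [::].
Proof.
move=> ab; exists 0, 1, 1; rewrite cats0.
exact: (@conn_zigzag a b (nb a) 1).
Qed.

(** Flipping [d] to [b] turns the square into a back-and-forth walk, which collapses spine by
    spine. *)
Lemma sim_square a b c d : e a b -> e b c -> e c d -> e d a ->
  sim a [:: b; c; d; a] [::].
Proof.
move=> ab bc cd da; apply: sim_trans (sim_spine ab).
apply: (@sim_trans _ _ [:: b; c; b; a]).
  apply: (@sim_cat _ [:: b; c] [:: b; c] [:: d; a] [:: b; a]).
    by apply: sim_refl; rewrite /= ab bc.
  by apply/(@sim_conn 1)/conn_flip => //; rewrite e_sym.
apply: (@sim_cat _ [:: b; c; b] [:: b] [:: a] [:: a]); last first.
  by apply: sim_refl; rewrite /= e_sym ab.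
apply: (@sim_cat _ [:: b] [:: b] [:: c; b] [::]); last exact: sim_spine.
by apply: sim_refl; rewrite /= ab.
Qed.

Definition wsim p q : Prop :=
  exists a s t, [/\ p = a :: s, q = a :: t & sim a s t].

Lemma wsim_refl p : walk e p -> wsim p p.
Proof. by case: p => // a s ps; exists a, s, s; split=> //; apply: sim_refl. Qed.

Lemma wsim_sym p q : wsim p q -> wsim q p.
Proof. by case=> a [s [t [-> -> /sim_sym st]]]; exists a, t, s. Qed.

Lemma wsim_trans p q r : wsim p q -> wsim q r -> wsim p r.
Proof.
case=> a [s [t [-> -> st]]] [b [t' [v [[<- <-] -> tv]]]].
by exists a, s, v; split=> //; apply: sim_trans tv.
Qed.

Lemma wsim_cycle u a s v : walk e (u ++ a :: v) -> sim a s [::] ->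
  wsim (u ++ a :: s ++ v) (u ++ a :: v).
Proof.
move=> wu sa; have [_ _ la _] := sim_inv sa.
case: u wu => [|x u] /= => [pv|].
  exists a, (s ++ v), v; split=> //; apply: (sim_cat sa).
  by rewrite la; apply: sim_refl.
rewrite cat_path /= => /and3P[pu ua pv].
exists x, (u ++ a :: s ++ v), (u ++ a :: v); split=> //.
rewrite -!(cat_rcons a); apply: (@sim_cat _ (rcons u a) (rcons u a)).
  by apply: sim_refl; rewrite rcons_path pu.
rewrite last_rcons -[v in X in sim _ _ X]cat0s; apply: (sim_cat sa).
by rewrite la; apply: sim_refl.
Qed.

Lemma wsim_phi p : walk e p -> wsim p (phi p).
Proof.
have: spine_steps p (phi p) by apply: phi_steps.
elim=> {p} [p q [u [a [b [v [-> ->]]]]] w|p|p q r pq IHpq _ IHqr wp].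
- apply: (@wsim_cycle u a [:: b; a] v).
    by apply: (walk_spine_steps _ w); apply: rt_step; exists u, a, b, v.
  apply: sim_spine; have: walk e ([:: a; b; a] ++ v) by apply: walk_cat_r w.
  by case/andP.
- exact: wsim_refl.
- exact: wsim_trans (IHpq wp) (IHqr (walk_spine_steps pq wp)).
Qed.

Lemma wsim_adds_square p q : walk e p -> adds_square e p q -> wsim p q.
Proof.
move=> wp [k [s [kp [[ws _] cs ls] s0 ->]]].
have kp' : k < size p by case: p wp kp {s0} => // x p _; rewrite ltnS.
case: s ws cs ls s0 => [|a [|b [|c [|d [|a' [|? ?]]]]]] // ws cs _ s0.
have Ea : p = take k p ++ a :: drop k.+1 p.
  rewrite -[LHS](cat_take_drop k) (drop_nth a kp'); congr (_ ++ _ :: _).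
  by move: s0; rewrite (onthE p) (nth_map a) //= => -[].
have Ei : insert_cycle p k [:: a; b; c; d; a'] =
  take k p ++ a :: [:: b; c; d; a'] ++ drop k.+1 p by [].
have wi : wsim (insert_cycle p k [:: a; b; c; d; a']) p.
  rewrite Ei {3}Ea; apply: wsim_cycle; first by rewrite -Ea.
  move: cs => /= /andP[/and5P[ab bc cd da _] /eqP Eaa]; rewrite Eaa in da *.
  exact: sim_square.
apply: wsim_trans (wsim_sym wi) (wsim_phi _).
case: wi => x [u [v [-> _ /sim_inv[pu _ _ _]]]]; exact: pu.
Qed.

Lemma wsim_square_equiv p q : square_equiv e p q -> p = q \/ wsim p q.
Proof.
elim=> {p q} [p q [[wp _] [wq _] []]|p|p q _ []|p q r _ [->|pq] _ [<-|qr]].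
- by right; apply: wsim_adds_square.
- by move/(wsim_adds_square wq)/wsim_sym; right.
- by left.
- by left.
- by right; apply: wsim_sym.
- by left.
- by right.
- by right.
- by right; apply: wsim_trans qr.
Qed.

Hypothesis e_sq : square_decomposable e.

Lemma sim_simple_cycle a s :
  path e a s -> last a s = a -> uniq s -> sim a s [::].
Proof.
move=> ps la us.
have [c [[cc lc] /wsim_square_equiv eqc]] : decomposable_into_squares e (a :: s).
  apply: e_sq; split; first by rewrite /= ps la eqxx.
  move=> i j /andP[ij js]; rewrite /walk_length /= in js *.
  case: j ij js => [//|j] ij js; case: i ij => [|i] ij.
    rewrite /= (onthE s) (nth_map a) // => -[Eaj]; split=> //.
    case: s ps la us js Eaj => [|x s] // _ la us js.
    rewrite -{1}la -nth_last /= => /(congr1 (index^~ (x :: s))).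
    by rewrite !index_uniq //= => ->.
  move=> /=; rewrite !onthE !(nth_map a) //; last exact: ltn_trans js.
  case=> /eqP; rewrite nth_uniq //; last exact: ltn_trans js.
  by move=> /eqP Eij; rewrite Eij ltnn in ij.
have := wsim_phi (ps : walk e (a :: s)).
case: c cc lc eqc => [|x [|? ?]] // _ _ [Ex|xp] => [|/wsim_trans/(_ xp)].
  by rewrite Ex; case=> b [u [v [[<- <-] [_ <-]]]].
by case=> b [u [v [[<- <-] [_ <-]]]].
Qed.

(** Letters are added one at a time. If the new letter already occurs, the part of the walk since
    that occurrence is a simple cycle, and it is contracted. *)
Lemma sim_shorten a s : path e a s -> exists2 t, uniq (a :: t) & sim a s t.
Proof.
elim/last_ind: s => [|s b IHs]; first by exists [::] => //; apply: sim_refl.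
rewrite rcons_path => /andP[/IHs[t ut st] sb].
have [_ pt lt _] := sim_inv st.
have pb : path e (last a s) [:: b] by rewrite /= sb.
have stb : sim a (rcons s b) (rcons t b).
  by rewrite -!cats1; apply: sim_cat st (sim_refl pb).
have [bt|bt] := boolP (b \in a :: t); last first.
  by exists (rcons t b) => //; rewrite -rcons_cons rcons_uniq bt.
have [u [v Ev]] : exists u v, a :: t = u ++ b :: v.
  by case/splitPr: bt => u v; exists u, v.
have wb : path e b (rcons v b).
  have [_ ptb _ _] := sim_inv stb.
  have : walk e (a :: rcons t b) by [].
  by rewrite -rcons_cons Ev rcons_cat => /walk_cat_r; apply.
have uv : uniq (rcons v b).
  by move: ut; rewrite Ev cat_uniq rcons_uniq => /and3P[_ _ ].
have sb0 := sim_simple_cycle wb (last_rcons _ _ _) uv.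
have wu : walk e (u ++ [:: b]).
  move: (pt : walk e (a :: t)); rewrite Ev -cat1s catA.
  case: u {Ev} => //= x u.
  by rewrite !cat_path => /andP[-> _].
have := wsim_cycle wu sb0; rewrite cats0 -rcons_cons -rcons_cat -Ev.
case=> x [s' [t' [[<- <-] Et tt']]]; exists t'; last exact: sim_trans stb tt'.
rewrite -Et cat_uniq; move: ut; rewrite Ev cat_uniq /= => /and3P[-> /norP[bu _] _].
by rewrite orbF andbT.
Qed.

(** * Shrinking in logarithmic time *)

Definition shrinks K I a s : Prop := exists t j,
  [/\ size t < #|V|, last a t = last a s
    & conn K a (s ++ Z (last a s) I) (t ++ Z (last a s) j)].

Lemma shrinks_le K K' I I' a s :
  K <= K' -> I <= I' -> shrinks K I a s -> shrinks K' I' a s.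
Proof.
move=> KK' /subnKC <- [t [j [tV lt /(conn_le KK') st]]].
exists t, (j + (I' - I)); split=> //; rewrite !ZD !catA; apply: conn_catr => //.
by rewrite last_cat last_Z path_Z.
Qed.

Lemma sim_shrinks a s : path e a s -> exists K, shrinks K K a s.
Proof.
move=> ps; have [t ut st] := sim_shorten ps.
have [_ _ lt _] := sim_inv st; case: st => i [j [k st]].
exists (i + k); apply: (@shrinks_le k _ i); rewrite ?leq_addl ?leq_addr //.
exists t, j; rewrite {3}lt; split=> //.
by have := max_card (mem (a :: t)); rewrite (card_uniqP ut).
Qed.

(** There are finitely many walks of length at most [M], so a maximum of the individual bounds
    works. *)
Lemma shrinks_bounded M : exists K, forall a s,
  path e a s -> size s <= M -> shrinks K K a s.
Proof.
have ex (x : V * {bseq M of V}) :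
    exists K, path e x.1 x.2 -> shrinks K K x.1 x.2.
  case: (boolP (path e x.1 x.2)) => [/sim_shrinks[K xK]|_]; last by exists 0.
  by exists K.
have [f Pf] := choice ex; exists (\max_x f x) => a s ps sM.
have := Pf (a, Bseq sM) ps; rewrite /=; have := leq_bigmax (F := f) (a, Bseq sM).
by move=> le; apply: shrinks_le.
Qed.

Section Slack.
Variable I0 : nat.
Hypothesis shrinks_I0 : forall a s,
  path e a s -> size s <= #|V|.*2 -> shrinks I0 I0 a s.

(** The time may depend on [m], but the slack [I0] does not: the spines released by shrinking a
    prefix serve again for the next letter. *)
Lemma shrinks_fixed m : exists K, forall a s,
  path e a s -> size s = m -> shrinks K I0 a s.
Proof.
elim: m => [|m [K IHm]].
  exists 0 => a s ps /size0nil ->; exists [::], I0.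
  by split=> //; [apply/card_gt0P; exists a|split=> //; apply: path_Z].
exists (I0 + (K + (2 + I0))) => a s.
case: (ltnP m.+1 #|V|) => [mV ps sm|Vm].
  exists s, I0; split; rewrite ?sm //; apply: conn_refl.
  by rewrite cat_path ps path_Z.
case/lastP: s => // s c; rewrite rcons_path size_rcons => /andP[ps sc] [sm].
have [t [j [tV ltE st]]] := IHm a s ps sm.
have [_ ptZ _ szt] := conn_inv st.
have {ptZ} pt : path e a t by move: ptZ; rewrite cat_path => /andP[].
(* Length is conserved, and [t] is no longer than [s] because [size t < #|V| <= m.+1]. *)
have jI : I0 <= j by move: szt; rewrite !size_cat !size_Z sm; lia.
have pc : path e (last a s) [:: c] by rewrite /= sc.
have [t' [j' [tV' lt' tt']]] : shrinks I0 j a (rcons t c).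
  apply: (shrinks_le (leqnn _) jI); apply: shrinks_I0.
    by rewrite rcons_path pt ltE.
  by rewrite size_rcons -addnn; lia.
exists t', j'; rewrite !last_rcons in lt' tt' *; split=> //.
apply: (@conn_trans I0 _ _ _ ((s ++ Z (last a s) I0) ++ [:: c])).
  rewrite -cats1 -!catA; apply: conn_catl => //.
  exact: (@conn_slide I0 _ [:: c]).
apply: (@conn_trans K _ _ _ ((t ++ Z (last a s) j) ++ [:: c])).
  by apply: conn_catr => //; rewrite last_cat last_Z.
apply: (conn_trans _ tt'); rewrite -cats1 -!catA; apply: conn_catl => //.
by rewrite ltE; apply: (@conn_pass j _ [:: c]).
Qed.

Let L := #|V| + I0.*2.

(* A word of length N_(k+1) is p1 p2 q with p1 of length N_k and q of length L; *)
(* shrinking q frees enough slack that the shrunk p2 q fits in a word of length *)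
(* N_k even after I0 of its spines have moved left of p2, for the use of p1.    *)
Fixpoint dyadic_length k := if k is k'.+1 then (dyadic_length k' + I0).*2 else L.

Lemma dyadic_length_ge k : L <= dyadic_length k.
Proof. by elim: k => //= k IHk; lia. Qed.

Lemma exp2_dyadic_length k : 0 < #|V| -> 2 ^ k <= dyadic_length k.
Proof.
move=> V0; elim: k => [|k IHk]; first by rewrite /= /L; lia.
by rewrite expnS /=; lia.
Qed.

Lemma shrinks_dyadic : exists C, forall k a s,
  path e a s -> size s = dyadic_length k -> shrinks (C * k.+1) I0 a s.
Proof.
(* Cost of one doubling: [KL] to shrink [q], [I0] to slide spines to the middle, [#|V|.*2] to carry
   the spines of the left half across [s2], and [I0] to shrink [s1 ++ s2]. *)
have [KL PL] := shrinks_fixed L; pose C := KL + I0 + #|V|.*2 + I0; exists C.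
elim=> [|k IHk] a s ps ss.
  by apply: shrinks_le (PL a s ps ss) => //; rewrite /C; lia.
have LN := dyadic_length_ge k; move: ss => /= ss.
set N := dyadic_length k in IHk LN ss.
have [p1 [p2 [q [Es sp1 sp2 sq]]]] : exists p1 p2 q,
    [/\ s = p1 ++ p2 ++ q, size p1 = N, size p2 = N + I0.*2 - L & size q = L].
  exists (take N s), (take (N + I0.*2 - L) (drop N s)),
    (drop (N + I0.*2 - L) (drop N s)).
  rewrite !cat_take_drop !size_drop !size_take_min size_drop ss; split=> //; lia.
move: ps; rewrite Es !cat_path => /and3P[pp1 pp2 pq].
have [q' [J [q'V lq' cq]]] := PL _ q pq sq.
rewrite /shrinks !last_cat; set b0 := last a p1 in pp2 pq lq' cq *.
set b1 := last b0 p2 in pq lq' cq *; set b2 := last b1 q in lq' cq *.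
have [_ ppq' _ szq] := conn_inv cq.
have {ppq'} pq' : path e b1 q' by move: ppq'; rewrite cat_path => /andP[].
rewrite !size_cat !size_Z sq in szq.
(* By conservation of length, as [q'] has fewer than [#|V|] letters. This leaves [I0] spines for
   each half. *)
have JI : I0.*2 <= J by rewrite /L in szq; lia.
pose r2 := p2 ++ q' ++ Z b2 (J - I0.*2).
have pr2 : path e b0 r2 by rewrite !cat_path pp2 pq' lq' path_Z.
have lr2 : last b0 r2 = b2 by rewrite !last_cat lq' last_Z.
have sr2 : size r2 = N by rewrite !size_cat size_Z sp2; lia.
have [s1 [J1 [s1V ls1 cs1]]] := IHk a p1 pp1 sp1.
have [s2 [J2 [s2V ls2 cs2]]] := IHk b0 r2 pr2 sr2.
rewrite -/b0 in ls1 cs1; rewrite lr2 in ls2 cs2.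
have [_ ps1 _ szs1] := conn_inv cs1; have [_ ps2 _ _] := conn_inv cs2.
have {ps1} ps1 : path e a s1 by move: ps1; rewrite cat_path => /andP[].
have {ps2} ps2 : path e b0 s2 by move: ps2; rewrite cat_path => /andP[].
rewrite !size_cat !size_Z sp1 in szs1.
have [t [j [tV lt ct]]] : shrinks I0 (J1 + J2) a (s1 ++ s2).
  apply: (@shrinks_le I0 _ I0) => //; first by rewrite /L in LN; lia.
  apply: shrinks_I0; first by rewrite cat_path ps1 ls1.
  by rewrite size_cat; lia.
rewrite last_cat ls1 ls2 in lt ct; exists t, j; split=> //.
apply: (@conn_le (KL + (I0 + (C * k.+1 + (#|V|.*2 + I0))))).
  by rewrite mulnS /C; lia.
apply: (@conn_trans _ _ _ _ (p1 ++ p2 ++ q' ++ Z b2 J)).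
  by rewrite -!catA; do 2 apply: conn_catl => //.
apply: (@conn_trans _ _ _ _ (p1 ++ (Z b0 I0 ++ r2) ++ Z b2 I0)).
  rewrite -(subnK JI) -addnn addnA !ZD !catA; apply: conn_catr; last first.
    by rewrite !last_cat -/b0 -/b1 lq' !last_Z path_Z.
  rewrite -!catA; apply: conn_catl => //; rewrite -/b0 !catA.
  by have := conn_slide I0 pr2; rewrite lr2 /r2 -addnn !catA.
apply: (@conn_trans _ _ _ _ ((s1 ++ Z b0 J1) ++ (s2 ++ Z b2 J2))).
  rewrite -(catA (Z b0 I0)) (catA p1); apply: conn_cat => //.
  by rewrite last_cat last_Z.
apply: conn_trans ct; rewrite ZD -!catA; apply: conn_catl => //; rewrite ls1 !catA.
apply: conn_catr; last by rewrite last_cat last_Z ls2 path_Z.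
rewrite -ls2; apply: conn_le (conn_pass J1 ps2); lia.
Qed.

End Slack.

Lemma shrinks_log : exists C I, forall n, exists2 N, n < N &
  forall a s, path e a s -> size s = N -> shrinks (C * (trunc_log 2 n).+1) I a s.
Proof.
have [I PI] := shrinks_bounded #|V|.*2; have [C PC] := shrinks_dyadic PI.
exists C.*2, I => n; pose k := (trunc_log 2 n).+1.
have [V0|V0] := posnP #|V|.
  by exists n.+1 => // a; have := max_card (pred1 a); rewrite V0 card1.
exists (dyadic_length I k).
  by apply: leq_trans (exp2_dyadic_length I k V0); apply: trunc_log_ltn.
move=> a s ps /(PC k a s ps); apply: shrinks_le => //.
by rewrite -muln2 -mulnA leq_mul2l; apply/orP; right; rewrite /k; lia.
Qed.

Hypothesis e_connected : forall a b, connect e a b.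
Variable r : V.

(** * Deformations of one-sided infinite walks *)

Definition alternate b c (i : nat) : V := if odd i then c else b.
Definition ray (w : nat -> V) : Prop := forall i, e (w i) (w i.+1).

Lemma ray_alternate b c : e b c -> ray (alternate b c).
Proof.
by move=> bc i; rewrite /alternate /=; case: odd; rewrite //= e_sym.
Qed.

(* No endpoint is fixed here: a ray may move by its own translation, and grids  *)
(* on N^2 extend to Z^2 by reflection.                                          *)
Definition settles (T : nat) (w : nat -> V) : Prop := exists rho k,
  [/\ rho 0 =1 w, forall j, ray (rho j), forall j i, e (rho j i) (rho j.+1 i)
    & forall j i, T <= j -> rho j i = alternate r (nb r) (i + j + k)].

Lemma settles_le T T' w : T <= T' -> settles T w -> settles T' w.
Proof.
move=> TT' [rho [k [r0 rr rc rT]]]; exists rho, k; split=> // t i T't.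
by apply: rT; apply: leq_trans T't.
Qed.

Lemma settles_eq T w w' : w =1 w' -> settles T w -> settles T w'.
Proof.
move=> ww' [rho [k [r0 rr rc rT]]]; exists rho, k; split=> // i.
by rewrite r0 ww'.
Qed.

Lemma settles_cons T w (w1 : nat -> V) : ray w -> (forall i, e (w i) (w1 i)) ->
  settles T w1 -> settles T.+1 w.
Proof.
move=> rw ww1 [rho [k [r0 rr rc rT]]].
exists (fun j => if j is j'.+1 then rho j' else w), k.+1.
split=> // [[|t] //|[|t] i //|[|t] i // tT]; first by rewrite r0.
by rewrite rT // /alternate !addnS addSn /= negbK.
Qed.

Lemma settles_shift m T w : ray w ->
  settles T (fun i => w (i + m)) -> settles (m + T) w.
Proof.
elim: m w => [|m IHm] w rw; first by apply: settles_eq => i; rewrite addn0.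
move=> st; apply: (@settles_cons _ _ (fun i => w i.+1)) => //.
apply: IHm => [i|]; first exact: rw.
by apply: settles_eq st => i; rewrite addnS.
Qed.

(** The alternation follows a path from [b] to [r]: the row [b c b c ..] may be followed by
    [d b d b ..] for any neighbour [d] of [b]. *)
Lemma settles_alternate b c : e b c -> settles #|V| (alternate b c).
Proof.
have /connectP[p pp lp] := e_connected b r; move: lp.
case/shortenP: pp => q pq uq _ {p}.
have qV : size q < #|V|.
  by have := max_card (mem (b :: q)); rewrite (card_uniqP uq).
move=> lq bc; apply: (settles_le qV) => {uq qV}.
elim: q b c bc pq lq => [|d q IHq] b c bc /=.
  move=> _ Er; rewrite -Er in bc *; apply: (@settles_cons _ _ (alternate (nb r) r)).
  - exact: ray_alternate.
  - by move=> i; rewrite /alternate; case: odd; rewrite // e_sym.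
  exists (fun j i => alternate r (nb r) (i + j + 1)), 1; split=> //.
  - by move=> i; rewrite /alternate addn0 addn1 /=; case: odd.
  - by move=> t i; rewrite !addSn; apply: ray_alternate.
  - by move=> t i; rewrite (addnS i) addSn; apply: ray_alternate.
move=> /andP[bd pq] lq; apply: (@settles_cons _ _ (alternate d b)).
- exact: ray_alternate.
- by move=> i; rewrite /alternate; case: odd; rewrite // e_sym.
- by apply: IHq => //; rewrite e_sym.
Qed.

(** Continuing by a zigzag makes appended spines invisible ([extend_Z]), so the slack of [shrinks]
    is free for rays. *)
Definition extend a s (i : nat) : V := nth a (a :: s ++ Z (last a s) i) i.

Lemma nth_zigzag x b c n i : i <= n.*2 ->
  nth x (b :: zigzag b c n) i = alternate b c i.
Proof.
elim: n i => [|n IHn] i; first by rewrite leqn0 => /eqP->.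
case: i => [|[|i]] // ni; rewrite zigzagS.
by rewrite -[LHS]/(nth x (b :: zigzag b c n) i) IHn // /alternate /= negbK.
Qed.

Lemma extendD a s i :
  extend a s (size s + i) = alternate (last a s) (nb (last a s)) i.
Proof.
rewrite /extend -cat_cons lastI cat_rcons nth_cat size_belast ltnNge leq_addr /=.
by rewrite addKn nth_zigzag // -addnn; lia.
Qed.

Lemma extendE a s m i : i <= size s + m.*2 ->
  extend a s i = nth a (a :: s ++ Z (last a s) m) i.
Proof.
case: (ltnP i (size s)) => [is_ _|/subnKC <-].
  by rewrite /extend -!cat_cons !nth_cat /= ltnS ltnW.
rewrite leq_add2l => im; rewrite extendD -cat_cons lastI cat_rcons nth_cat.
by rewrite size_belast ltnNge leq_addr /= addKn nth_zigzag.
Qed.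

Lemma extend_Z a s j : extend a (s ++ Z (last a s) j) =1 extend a s.
Proof.
move=> i; rewrite /extend last_cat last_Z -catA -ZD -extendE //.
by rewrite -addnn; lia.
Qed.

Lemma ray_extend a s : path e a s -> ray (extend a s).
Proof.
move=> ps i; have im : i.+1 <= size s + i.+1.*2 by lia.
rewrite !(@extendE _ _ i.+1) // ?(ltnW im) //=.
have /(pathP a) : path e a (s ++ Z (last a s) i.+1) by rewrite cat_path ps path_Z.
by apply; rewrite size_cat size_Z.
Qed.

Lemma all2_nth (x y : V) s t i :
  all2 e s t -> i < size s -> e (nth x s i) (nth y t i).
Proof.
by elim: s t i => [|a s IHs] [|b t] [|i] //= /andP[ab st] //; apply: IHs.
Qed.

Lemma drift_extend a s t i : drift a s t -> e (extend a s i) (extend a t i.+1).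
Proof.
move=> st; have sz := drift_size st; have /and4P[_ _ /eqP lt _] := st.
have im : i.+1 <= size s + i.+1.*2 by lia.
rewrite !(@extendE _ _ i.+1) // -?sz -?lt ?(ltnW im) //.
have /and4P[_ _ _ al] := drift_cat st (drift_refl (path_Z (last a s) i.+1)).
have := all2_nth a a al; rewrite size_belast size_cat size_Z => /(_ _ im).
by rewrite [in X in _ -> e X _]lastI nth_rcons size_belast size_cat size_Z im.
Qed.

(** The intermediate row is the extension of [v] translated by one, which undoes the offset of
    [drift]; hence two rows per step. *)
Lemma settles_extend_step a s t T :
  step a s t -> settles T (extend a t) -> settles T.+2 (extend a s).
Proof.
move=> [v [sv tv]] st; have /and4P[ps pv _ _] := sv; have /and4P[pt _ _ _] := tv.
apply: (@settles_cons _ _ (fun i => extend a v i.+1)).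
- exact: ray_extend.
- by move=> i; apply: drift_extend.
apply: settles_cons st => i; first exact: ray_extend.
by rewrite e_sym; apply: drift_extend.
Qed.

Lemma settles_extend_conn k a s t T :
  conn k a s t -> settles T (extend a t) -> settles (k.*2 + T) (extend a s).
Proof.
elim: k s => [|k IHk] s /=; first by case=> _ ->.
by case=> v [sv vt] /(IHk _ vt); apply: settles_extend_step.
Qed.

Lemma settles_extend a s : path e a s -> settles (size s + #|V|) (extend a s).
Proof.
move=> ps; apply: settles_shift; first exact: ray_extend.
apply: settles_eq (settles_alternate (e_nb (last a s))) => i.
by rewrite addnC extendD.
Qed.

Lemma settles_ray : exists C, forall n w, ray w ->
  (forall i, n <= i -> w i.+2 = w i) -> settles (C * (trunc_log 2 n).+1) w.
Proof.
have [C [I PC]] := shrinks_log; exists (2 + C.*2 + #|V|.*2) => n w rw wn.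
have [N nN {}PC] := PC n; pose s := mkseq (fun i => w i.+1) N.
have nths i : i <= N -> nth (w 0) (w 0 :: s) i = w i.
  by case: i => // i iN; rewrite /= nth_mkseq.
have ps : path e (w 0) s.
  apply/(pathP (w 0)) => i; rewrite size_mkseq => iN.
  by rewrite nths ?(ltnW iN) // nth_mkseq.
have sN : size s = N by rewrite size_mkseq.
have lst : last (w 0) s = w N by rewrite (last_nth (w 0)) sN nths.
have [t [j [tV lt st]]] := PC _ _ ps sN.
have [_ ptZ _ _] := conn_inv st.
have {ptZ} pt : path e (w 0) t by move: ptZ; rewrite cat_path => /andP[].
set K := C * _ in st.
apply: (@settles_le (K.*2 + (size t + #|V|)).+2).
  by rewrite /K; move: (trunc_log 2 n) => l; nia.
(* Beyond [N], [w] alternates between [w N] and [w N.+1], whereas the extension uses [nb (w N)]. Two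
   additional rows replace one neighbour of [w N] by the other. *)
apply: (@settles_cons _ _ (fun i => extend (w 0) s i.+1)) => // [i|].
  have [iN|Ni] := ltnP i N.
    by rewrite (@extendE _ _ 0) ?cats0 ?sN ?addn0 // nths.
  rewrite -(subnKC Ni) -addnS -sN extendD lst sN.
  have : forall i, w (N + i) = alternate (w N) (w N.+1) i.
    move=> l; rewrite /alternate; elim: l {-2}l (leqnn l) => [|m IHm] [|[|l]] //.
    - by rewrite addn0.
    - by rewrite addn0.
    - by rewrite addn1.
    move=> lm; rewrite !addnS wn; first by rewrite IHm /= ?negbK // -ltnS ltnW.
    by rewrite (leq_trans (ltnW nN)) ?leq_addr.
  move=> ->; rewrite /alternate /=; case: odd => //=; by rewrite e_sym.
apply: settles_cons; first by move=> i; apply: ray_extend.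
  by move=> i; rewrite e_sym; apply: ray_extend.
apply: (settles_eq (extend_Z _ _ I)); apply: settles_extend_conn st _.
by rewrite -lt; apply: settles_eq (fsym (extend_Z _ _ j)) (settles_extend pt).
Qed.

(** A walk without repeated vertex that returns to its origin is empty, and homotopy preserves
    parity. *)
Lemma closed_walk_even a s : path e a s -> last a s = a -> ~~ odd (size s).
Proof.
move=> ps la; have [t ut /sim_inv[_ _ lt ->]] := sim_shorten ps.
case: t ut lt => // b t /= /andP[at_ _]; rewrite la => Ea.
by rewrite {1}Ea mem_last in at_.
Qed.

End WalkMoves.

(** * Configurations of the plane *)

Section Plane.
Variables (V : finType) (e : rel V).
Hypothesis e_sym : symmetric e.
Implicit Types (x y z : int * int -> V) (u v : int * int).

Lemma hom_shiftP x : hom_shift e x <->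
  (forall i j, e (x (i, j)) (x (i + 1, j))) /\
  (forall i j, e (x (i, j)) (x (i, j + 1))).
Proof.
split=> [hx|[hh hv] [a b] [c d]].
  by split=> i j; apply: hx; rewrite /norm1 /=; lia.
rewrite /norm1 /= => abcd.
have : [\/ a = c + 1 /\ b = d, c = a + 1 /\ b = d, a = c /\ b = d + 1
  | a = c /\ d = b + 1].
  have : (a = c + 1 /\ b = d) \/ (c = a + 1 /\ b = d) \/ (a = c /\ b = d + 1)
    \/ (a = c /\ d = b + 1) by lia.
  case=> [|[|[|]]] ?; [exact: Or41|exact: Or42|exact: Or43|exact: Or44].
by case=> -[-> ->]; rewrite // e_sym.
Qed.

Lemma hom_shift_comp x (phi psi : int -> int) : hom_shift e x ->
  (forall i, absz (phi (i + 1) - phi i)%R = 1%N) ->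
  (forall i, absz (psi (i + 1) - psi i)%R = 1%N) ->
  hom_shift e (fun u => x (phi u.1, psi u.2)).
Proof.
move=> hx hphi hpsi; apply/hom_shiftP; split=> i j; apply: hx; rewrite /norm1 /=.
  by rewrite subrr absz0 addn0 distnC.
by rewrite subrr absz0 add0n distnC.
Qed.

Lemma hom_shift_swap x : hom_shift e x -> hom_shift e (fun u => x (u.2, u.1)).
Proof. by move=> /hom_shiftP[h v]; apply/hom_shiftP; split. Qed.

Lemma hom_shift_cut x y (k : int) : hom_shift e x -> hom_shift e y ->
  (forall i, x (i, k) = y (i, k)) ->
  hom_shift e (fun u => if k <= u.2 then x u else y u).
Proof.
move=> /hom_shiftP[xh xv] /hom_shiftP[yh yv] xy; apply/hom_shiftP.
split=> i j /=; first by case: ifP.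
have [kj|jk] := lerP k j; first by rewrite (le_trans kj) // lerDl.
have [kj|//] := lerP k (j + 1).
have Ek : j + 1 = k by lia.
by rewrite Ek xy -Ek.
Qed.

Lemma odd_abszB (i j : int) :
  odd (absz (i - j)%R) = odd (absz i) (+) odd (absz j).
Proof. lia. Qed.

(* Precomposition with bounce n keeps the columns 0 .. n of a configuration and *)
(* makes its rows periodic beyond them.                                         *)
Definition bounce (n k : nat) : nat :=
  if (k <= n)%N then k else (n - odd (k - n))%N.

Lemma bounce_le n k : (k <= n)%N -> bounce n k = k.
Proof. by rewrite /bounce => ->. Qed.

Lemma bounce_ge n k : (n <= k)%N -> bounce n k = (n - odd (k - n))%N.
Proof.
rewrite /bounce; case: (leqP k n) => // kn nk.
have -> : k = n by lia.
by rewrite subnn subn0.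
Qed.

Lemma bounceS n k :
  (0 < n)%N -> absz ((bounce n k.+1)%:Z - (bounce n k)%:Z)%R = 1%N.
Proof.
move=> n0; case: (ltnP k n) => [kn|nk].
  by rewrite !bounce_le ?(ltnW kn) //; lia.
by rewrite !bounce_ge ?(leqW nk) // subSn //=; case: odd => /=; lia.
Qed.

Lemma bounceSS n k : (n <= k)%N -> bounce n k.+2 = bounce n k.
Proof.
by move=> nk; rewrite !bounce_ge ?leqW // !subSn ?leqW //= negbK.
Qed.

Lemma hom_shift_bounce x n : (0 < n)%N -> hom_shift e x ->
  hom_shift e (fun u => x ((bounce n (absz u.1))%:Z, u.2)).
Proof.
move=> n0 hx.
apply: (@hom_shift_comp x (fun i => (bounce n (absz i))%:Z) id) => // i;
  last by lia.
have [->|->] : absz (i + 1)%R = (absz i).+1 \/ absz i = (absz (i + 1)%R).+1.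
- lia.
  exact: bounceS.
by have := bounceS (absz (i + 1)%R) n0; lia.
Qed.


(** * Gluing two blocks through striped half-planes *)

Variable nb : V -> V.
Hypothesis e_nb : forall a, e a (nb a).
Variable r : V.

Definition settling_time n T : Prop := forall w, ray e w ->
  (forall i, (n <= i)%N -> w i.+2 = w i) -> settles e nb r T w.

Definition stripes (k : nat) (i j : int) : V :=
  alternate r (nb r) (absz i + absz j + k)%N.

(** Row 0, made periodic by [bounce], evolves downwards in place of the lower half of [x]. Absolute
    values reflect this one-sided evolution to negative columns. *)
Lemma hom_shift_settled x n T : (0 < n)%N -> hom_shift e x ->
  settling_time n T ->
  exists z k, [/\ hom_shift e z,
    forall i j : nat, (i <= n)%N -> z (i%:Z, j%:Z) = x (i%:Z, j%:Z)
    & forall i j : int, j < - T%:Z -> z (i, j) = stripes k i j].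
Proof.
move=> n0 hx; have /= hxb := hom_shift_bounce n0 hx.
have /hom_shiftP[xbh _] := hxb.
move=> /(_ (fun i => x ((bounce n i)%:Z, 0)))[i|i ni|rho [k [r0 rr rc rT]]].
- by have := xbh i%:Z 0; rewrite [absz (_, _).1]/= (_ : absz (i%:Z + 1)%R = i.+1) //; lia.
- by rewrite bounceSS.
exists (fun u => if 0 <= u.2 then x ((bounce n (absz u.1))%:Z, u.2)
  else rho (absz u.2) (absz u.1)), k; split=> [|i j iN|i j jT].
- apply: hom_shift_cut => //.
  have absS (i : int) : absz (i + 1)%R = (absz i).+1 \/ absz i = (absz (i + 1)%R).+1 by lia.
  apply/hom_shiftP; split=> i j /=.
    by have [->|->] := absS i; [|rewrite e_sym]; apply: rr.
  by have [->|->] := absS j; [|rewrite e_sym]; apply: rc.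
- by rewrite /= /bounce iN.
- by rewrite /= ifF ?rT //; lia.
Qed.

(* One of the two patterns moves by at most one column, which matches the      *)
(* parities of the two striped half-planes.                                    *)
Lemma glue_above x1 x2 n T (u u' : int * int) : (0 < n)%N ->
  settling_time n T ->
  hom_shift e x1 -> hom_shift e x2 ->
  u'.2 + n%:Z + T.*2.+2%:Z <= u.2 ->
  exists z (d : bool), [/\ hom_shift e z,
    forall i j, (i < n)%N -> (j < n)%N -> z (u + (i%:Z, j%:Z)) = x1 (i%:Z, j%:Z)
    & forall i j, (i < n)%N -> (j < n)%N ->
        z (u' + (d%:Z, 0) + (i%:Z, j%:Z)) = x2 (i%:Z, j%:Z)].
Proof.
case: u u' => [a b] [a' b'] n0 sT h1 h2 /= bb'.
have [z1 [k1 [hz1 z1x z1s]]] := hom_shift_settled n0 h1 sT.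
(* The lower configuration is turned upside down, so that it settles upwards from its top row. *)
have h2r : hom_shift e (fun u => x2 (u.1, n%:Z - 1 - u.2)).
  by apply: (hom_shift_comp (phi := id) (psi := fun j => n%:Z - 1 - j)) => // i; lia.
have [z2 [k2 [hz2 z2x z2s]]] := hom_shift_settled n0 h2r sT.
(* A row where both configurations are already striped; the margin [T.*2.+2] leaves [T.+1] rows on
   each side. *)
pose j0 := b - T%:Z - 1.
have [p Ep] : exists p, absz (j0 - b)%R = p by eexists.
have [q Eq] : exists q, absz (b' + n%:Z - 1 - j0)%R = q by eexists.
pose d := odd (absz a + p + k1 + (absz a' + q + k2))%N.
pose y1 v := z1 (v.1 - a, v.2 - b).
pose y2 v := z2 (v.1 - a' - d%:Z, b' + n%:Z - 1 - v.2).
exists (fun v => if j0 <= v.2 then y1 v else y2 v), d; split=> [|i j iN jn|i j iN jn].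
- apply: hom_shift_cut => [||i].
  + by apply: (hom_shift_comp (phi := fun i => i - a) (psi := fun j => j - b)) => // i; lia.
  + by apply: (hom_shift_comp (phi := fun i => i - a' - d%:Z)
      (psi := fun j => b' + n%:Z - 1 - j)) => // i; lia.
  rewrite /y1 /y2 z1s /=; last by rewrite /j0; lia.
  rewrite z2s /=; last by rewrite /j0; lia.
  rewrite /stripes /alternate; congr (if _ then _ else _).
  rewrite Ep Eq !oddD !odd_abszB /= oddb /d !oddD.
  by do 7 case: (odd _).
- rewrite /= ifT; last by rewrite /j0; lia.
  by rewrite /y1 /= ![_ + _%:Z]addrC !addrK z1x // ltnW.
- rewrite /= ifF; last by rewrite /j0; lia.
  have -> : y2 ((a', b') + (d%:Z, 0) + (i%:Z, j%:Z)) = z2 (i%:Z, (n.-1 - j)%N%:Z).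
    rewrite /y2 /=; have -> : a' + d%:Z + i%:Z - a' - d%:Z = i%:Z by lia.
    by have -> : b' + n%:Z - 1 - (b' + 0 + j%:Z) = (n.-1 - j)%N%:Z by lia.
  rewrite z2x ?(ltnW iN) //=.
  by have -> : n%:Z - 1 - (n.-1 - j)%N%:Z = j%:Z by lia.
Qed.

Lemma glue_vertical x1 x2 n T u u' : (0 < n)%N ->
  settling_time n T ->
  hom_shift e x1 -> hom_shift e x2 ->
  (n + T.*2.+2 <= absz (u.2 - u'.2)%R)%N ->
  exists z v, [/\ hom_shift e z, (norm_oo v < 2)%N,
    forall i j, (i < n)%N -> (j < n)%N -> z (u + (i%:Z, j%:Z)) = x1 (i%:Z, j%:Z)
    & forall i j, (i < n)%N -> (j < n)%N ->
        z (u' + v + (i%:Z, j%:Z)) = x2 (i%:Z, j%:Z)].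
Proof.
move=> n0 sT h1 h2 uu'; have [le|le] : u'.2 + n%:Z + T.*2.+2%:Z <= u.2 \/
  u.2 + n%:Z + T.*2.+2%:Z <= u'.2 by lia.
  have [z [d [hz z1 z2]]] := glue_above n0 sT h1 h2 le.
  by exists z, (d%:Z, 0); split=> //; rewrite /norm_oo; case: (d).
have [z [d [hz z2 z1]]] := glue_above n0 sT h2 h1 le.
(* Here the first pattern is the one that was displaced; translating the plane back transfers the
   displacement to the second. *)
exists (fun w => z (w.1 + d%:Z, w.2)), (- d%:Z, 0); split=> [|||].
- by apply: (hom_shift_comp (phi := fun i => i + d%:Z) (psi := id)) => // i; lia.
- by rewrite /norm_oo; case: (d).
- move=> i j iN jn; rewrite -(z1 i j iN jn) /=; congr (z (_, _)).
    by rewrite addrAC.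
  by rewrite /= addr0.
- move=> i j iN jn; rewrite -(z2 i j iN jn) /=; congr (z (_, _)).
    by rewrite addrAC subrK.
  by rewrite /= addr0.
Qed.

Lemma glue x1 x2 n T u u' : (0 < n)%N ->
  settling_time n T ->
  hom_shift e x1 -> hom_shift e x2 ->
  (n + T.*2.+2 <= norm_oo (u - u')%R)%N ->
  exists z v, [/\ hom_shift e z, (norm_oo v < 2)%N,
    forall i j, (i < n)%N -> (j < n)%N -> z (u + (i%:Z, j%:Z)) = x1 (i%:Z, j%:Z)
    & forall i j, (i < n)%N -> (j < n)%N ->
        z (u' + v + (i%:Z, j%:Z)) = x2 (i%:Z, j%:Z)].
Proof.
move=> n0 sT h1 h2; rewrite leq_max => /orP[uu'|]; last exact: glue_vertical.
have [z [v [hz vn z1 z2]]] := @glue_vertical _ _ n T (u.2, u.1) (u'.2, u'.1) n0 sT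
  (hom_shift_swap h1) (hom_shift_swap h2) uu'.
exists (fun w => z (w.2, w.1)), (v.2, v.1); split=> [||i j iN jn|i j iN jn].
- exact: hom_shift_swap hz.
- by rewrite /norm_oo maxnC.
- exact: (z1 j i jn iN).
- exact: (z2 j i jn iN).
Qed.

(** Converts the distance between blocks into one between their corners, separately in each
    coordinate. *)
Lemma close_offsets n m (k : int) : (0 < n)%N -> (absz k < n + m)%N ->
  exists i j : 'I_n, (absz (k + i%:Z - j%:Z)%R <= m)%N.
Proof.
case: n => // n _ kn; have [k0|k0] := lerP 0 k.
  exists ord0, (inord (minn (absz k) n)); rewrite inordK ?ltnS ?geq_minr //=.
  lia.
exists (inord (minn (absz k) n)), ord0; rewrite inordK ?ltnS ?geq_minr //=.
lia.
Qed.

Lemma hom_shift_gluing (T : nat -> nat) :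
  (forall n, settling_time n (T n)) ->
  phased_block_gluing (hom_shift e) (fun n => (T n).*2.+3) 2.
Proof.
move=> sT n n0 p p' [x1 [w1 [h1 p1]]] [x2 [w2 [h2 p2]]] u u' /(leq_block_dist _ _ _ n0) d.
have uu' : (n + (T n).*2.+2 <= norm_oo (u - u')%R)%N.
  rewrite leqNgt; apply/negP; rewrite gtn_max => /andP[c1 c2].
  have [i1 [j1 ij1]] := close_offsets n0 c1.
  have [i2 [j2 ij2]] := close_offsets n0 c2.
  have := d (i1, i2) (j1, j2); rewrite leqNgt => /negP; apply.
  rewrite gtn_max !ltnS /= !opprD !addrA.
  by move: ij1 ij2; rewrite /= => ij1 ij2; apply/andP; split; lia.
pose y1 v := x1 (v.1 + w1.1, v.2 + w1.2); pose y2 v := x2 (v.1 + w2.1, v.2 + w2.2).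
have hy1 : hom_shift e y1.
  by apply: (hom_shift_comp (phi := fun i => i + w1.1) (psi := fun i => i + w1.2)) => // i; lia.
have hy2 : hom_shift e y2.
  by apply: (hom_shift_comp (phi := fun i => i + w2.1) (psi := fun i => i + w2.2)) => // i; lia.
have [z [v [hz vn z1 z2]]] := glue n0 (sT n) hy1 hy2 uu'.
exists z, v; split=> // -[i j]; rewrite /cell.
  by rewrite z1 // -p1 /y1 /cell /= addrC [X in (_, X)]addrC.
by rewrite z2 // -p2 /y2 /cell /= addrC [X in (_, X)]addrC.
Qed.

End Plane.

(** * Phase and gluing gap *)

Lemma gluing_gap_exists (A : Type) (X : (int * int -> A) -> Prop) theta f :
  is_phase X theta -> phased_block_gluing X f theta ->
  exists gamma, is_gluing_gap X gamma /\
    forall n, (0 < n)%N -> (gamma n <= f n)%N.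
Proof.
move=> ph ff; pose P n m := forall p p' : pattern A n,
  globally_admissible X p -> globally_admissible X p' ->
  forall u u' : int * int, (m <= block_dist n u u')%N ->
  exists x v, [/\ X x, (norm_oo v < theta)%N, appears_at p x u
                & appears_at p' x (u' + v)].
have [gamma Pg] : exists gamma : nat -> nat, forall n, (0 < n)%N ->
    P n (gamma n) /\ forall m, P n m -> (gamma n <= m)%N.
  have ex n : exists m, (0 < n)%N -> P n m /\ forall m', P n m' -> (m <= m')%N.
    case: n => [|n]; first by exists 0%N.
    have exP : exists m, `[< P n.+1 m >] by exists (f n.+1); apply/asboolP/ff.
    case: (ex_minnP exP) => m /asboolP Pm minm; exists m => _; split=> // m' Pm'.
    by apply: minm; apply/asboolP.
  by have [g Pg] := choice ex; exists g.
exists gamma; split; last by move=> n n0; apply: (Pg n n0).2; apply: ff.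
exists theta; split=> // [n n0|g gg n n0]; first exact: (Pg n n0).1.
by apply: (Pg n n0).2; apply: gg.
Qed.

(** With no displacement allowed, two occurrences of [r] at an odd distance on one row would be
    joined by a closed walk of odd length. *)
Lemma not_phase1 (V : finType) (e : rel V) (nb : V -> V) (r : V) f :
  symmetric e -> (forall a, e a (nb a)) -> square_decomposable e ->
  ~ phased_block_gluing (hom_shift e) f 1.
Proof.
move=> e_sym e_nb e_sq ff.
pose x (u : int * int) := alternate r (nb r) (absz u.1 + absz u.2)%N.
have hx : hom_shift e x.
  have xS i j : odd j = ~~ odd i -> e (alternate r (nb r) i) (alternate r (nb r) j).
    by rewrite /alternate => ->; case: odd; rewrite //= e_sym.
  apply/(hom_shiftP e_sym); split=> i j; apply: xS => /=; lia.
pose p : pattern V 1 := [ffun=> r].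
have ap : globally_admissible (hom_shift e) p.
  by exists x, 0; split=> // i; rewrite ffunE /cell !ord1.
pose d := (f 1%N).*2.+1.
have [|y [v [hy v0 p0 pd]]] := ff 1%N isT p p ap ap 0 (d%:Z, 0).
  by apply/leq_block_dist => // -[i j] [i' j']; rewrite !ord1 leq_max /= /d; lia.
have {v0} v0 : v = 0.
  by case: v v0 {pd} => a b; rewrite gtn_max /= => ab; congr (_, _); lia.
have y0 : y (0, 0) = r by have := p0 (ord0, ord0); rewrite ffunE.
have yd : y (d%:Z, 0) = r.
  by have := pd (ord0, ord0); rewrite ffunE v0 /cell /= !addr0.
pose s := mkseq (fun i => y (i.+1%:Z, 0)) d.
have nths i : (i <= d)%N -> nth r (r :: s) i = y (i%:Z, 0).
  by case: i => [|i] iN; rewrite /= ?y0 // nth_mkseq.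
have ps : path e r s.
  apply/(pathP r) => i; rewrite size_mkseq => iN.
  rewrite nths ?(ltnW iN) // nth_mkseq // intS addrC.
  by have /(hom_shiftP e_sym)[+ _] := hy; apply.
have ls : last r s = r by rewrite (last_nth r) size_mkseq nths.
have := closed_walk_even e_sym e_nb e_sq ps ls.
by rewrite size_mkseq /d /= odd_double.
Qed.

Lemma trunc_log_le_ln (R : realType) n : (0 < n)%N ->
  (trunc_log 2 n)%:R * ln 2 <= ln n%:R :> R.
Proof.
move=> n0; rewrite mulr_natl -lnXn ?ltr0n // ler_ln ?posrE ?exprn_gt0 ?ltr0n //.
by rewrite -natrX ler_nat trunc_logP.
Qed.

Theorem theorem6p15 (R : realType) (V : finType) (e : rel V)
    (e_sym : symmetric e) (e_connected : forall a b : V, connect e a b) :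
  square_decomposable e ->
  exists gamma : nat -> nat,
    is_gluing_gap (hom_shift e) gamma /\
    is_bigO (fun n => (gamma n)%:R : R) (fun n => ln (n%:R : R)).
Proof.
move=> e_sq; have [[r [r' rr']]|no_edge] := pselect (exists a b, e a b); last first.
  (* Without edges the shift is empty, no pattern is admissible, and the gap is 0 at phase 1. *)
  have gl0 : phased_block_gluing (hom_shift e) (fun=> 0%N) 1.
    move=> n _ p p' [x [_ [hx _]]]; case: no_edge.
    by exists (x 0), (x (1, 0)); apply: hx.
  have ph : is_phase (hom_shift e) 1 by split=> //; exists (fun=> 0%N).
  have [gamma [gg g0]] := gluing_gap_exists ph gl0.
  exists gamma; split=> //; exists 1, 1; split=> // n n0.
  have := g0 n n0; rewrite leqn0 => /eqP ->.
  by rewrite mul1r addr_ge0 // ln_ge0 // ler1n.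
have [nb e_nb] : exists nb : V -> V, forall a, e a (nb a).
  have ex a : exists b, e a b.
    have /connectP[[|b q] /= pq lq] := e_connected a r.
      by exists r'; rewrite -lq.
    by exists b; case/andP: pq.
  by have [nb e_nb] := choice ex; exists nb.
have [C sC] := settles_ray e_sym e_nb e_sq e_connected r.
have gl := hom_shift_gluing e_sym sC.
have ph : is_phase (hom_shift e) 2.
  split=> //; first by eexists; exact: gl.
  move=> [|[|k]] // f _ /(not_phase1 r e_sym e_nb e_sq) [].
have [gamma [gg gf]] := gluing_gap_exists ph gl.
exists gamma; split=> //.
have ln2 : 0 < ln 2 :> R by rewrite ln_gt0 // ltr1n.
(* The gap is at most [2 C (l + 1) + 3] with [l = trunc_log 2 n]; the successor keeps the factor
   positive when [C] is 0. *)
exists (C.*2.+1%:R / ln 2), (C.*2 + 3)%:R; split=> [||n n0].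
- by rewrite divr_gt0 ?ltr0n.
- by rewrite ltr0n addnS.
have lnn := trunc_log_le_ln R n0; set l := trunc_log 2 n in lnn.
apply: (@le_trans _ _ (C.*2.+1 * l + (C.*2 + 3))%:R).
  by rewrite ler_nat; apply: leq_trans (gf n n0) _; rewrite -/l; nia.
rewrite natrD natrM lerD2r -mulrA ler_wpM2l ?ler0n //.
by rewrite mulrC ler_pdivlMr.
Qed.
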